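(* Assume $\mu$-strong convexity and $(\epsilon_i)$-sensitivity (spelled out in the context), and suppose that $\ell(\boldsymbol\theta;z)$ is $L_z$-Lipschitz in $z$ (for every $\boldsymbol\theta$, with respect to the Euclidean norm). Then for every performative stable solution $\boldsymbol\theta^{PS}$ and every performative optimal solution $\boldsymbol\theta^{PO}$, $$\|\boldsymbol\theta^{PS}-\boldsymbol\theta^{PO}\|_2\le\frac{2L_z\overline\epsilon}{\mu},\qquad \overline\epsilon:=\sum_{i=1}^Np_i\epsilon_i .$$
   Context: Setting. $N,m,M\ge 1$; weights $p_1,\dots,p_N>0$ with $\sum_i p_i=1$; $\mathcal Z\subseteq\mathbb R^M$. For each client $i$ and each $\boldsymbol\theta\in\mathbb R^m$, $\mathcal D_i(\boldsymbol\theta)$ is a probability distribution on $\mathcal Z$. $\ell(\boldsymbol\theta;z)$ is a real-valued loss. $f_i(\boldsymbol\theta;\tilde{\boldsymbol\theta}):=\mathbb E_{Z\sim\mathcal D_i(\tilde{\boldsymbol\theta})}[\ell(\boldsymbol\theta;Z)]$ (assumed finite), $f:=\sum_i p_i f_i$, differentiable in its first argument; $\nabla f$ is the gradient in the first argument. A performative stable solution is a point $\boldsymbol\theta^{PS}$ with $\boldsymbol\theta^{PS}\in\arg\min_{\boldsymbol\theta}f(\boldsymbol\theta;\boldsymbol\theta^{PS})$. A performative optimal solution is a point $\boldsymbol\theta^{PO}\in\arg\min_{\boldsymbol\theta\in\mathbb R^m}f(\boldsymbol\theta;\boldsymbol\theta)$. Assumptions (for all $\boldsymbol\theta,\boldsymbol\theta',\tilde{\boldsymbol\theta}\in\mathbb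 R^m$ and all $i$): - $\mu$-strong convexity ($\mu>0$): $f(\boldsymbol\theta';\tilde{\boldsymbol\theta})\ge f(\boldsymbol\theta;\tilde{\boldsymbol\theta})+\langle\nabla f(\boldsymbol\theta;\tilde{\boldsymbol\theta}),\boldsymbol\theta'-\boldsymbol\theta\rangle+\frac\mu2\|\boldsymbol\theta'-\boldsymbol\theta\|_2^2$. - $(\epsilon_i)$-sensitivity ($\epsilon_i>0$): $\mathcal W_1(\mathcal D_i(\boldsymbol\theta),\mathcal D_i(\boldsymbol\theta'))\le\epsilon_i\|\boldsymbol\theta-\boldsymbol\theta'\|_2$, with $\mathcal W_1$ the 1-Wasserstein distance for the Euclidean norm. *)

(* Defs.v *)
From HB Require Import structures.
From mathcomp Require Import all_boot all_order all_algebra.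
From mathcomp Require Import all_classical all_reals all_analysis.
Import Order.TTheory GRing.Theory Num.Theory.
Import numFieldNormedType.Exports.

Set Implicit Arguments.
Unset Strict Implicit.
Unset Printing Implicit Defensive.

Local Open Scope classical_set_scope.
Local Open Scope ring_scope.

Definition dotp (R : realType) (n : nat) (u v : 'rV[R]_n) : R :=
  \sum_(i < n) u 0 i * v 0 i.

(* The library norm on row vectors is the sup norm; it induces the same
   topology and the same notion of differentiability. *)
Definition norm2 (R : realType) (n : nat) (u : 'rV[R]_n) : R :=
  Num.sqrt (dotp u u).

(* the gradient when g is differentiable at x *)
Definition gradient (R : realType) (n : nat) (g : 'rV[R]_n -> R)
    (x : 'rV[R]_n) : 'rV[R]_n :=
  \row_(i < n) 'D_(delta_mx 0 i) g x.

Definition argmin (R : realType) (T : Type) (g : T -> R) : set T :=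
  [set x | forall y, g x <= g y].

(* Nonemptiness of Z is only needed because measurable types are pointed; it is
   implied by the existence of a probability distribution on Z. *)
Definition pointed_set (T : choiceType) (Z : set T) (Z0 : Z !=set0) : Type :=
  set_type Z.

HB.instance Definition _ (T : choiceType) (Z : set T) (Z0 : Z !=set0) :=
  Choice.copy (pointed_set Z0) (set_type Z).
HB.instance Definition _ (T : choiceType) (Z : set T) (Z0 : Z !=set0) :=
  isPointed.Build (pointed_set Z0) (SigSub (mem_set (projT2 (cid Z0)))).

(* Z with the Borel sigma-algebra of its subspace topology *)
Definition borel_space (R : realType) (n : nat) (Z : set 'rV[R]_n)
    (Z0 : Z !=set0) :=
  g_sigma_algebraType (@open (set_type Z) : set (set (pointed_set Z0))).

Definition dist2 (R : realType) (n : nat) (Z : set 'rV[R]_n) (Z0 : Z !=set0)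
    (x y : borel_space Z0) : R :=
  norm2 (set_val (x : set_type Z) - set_val (y : set_type Z)).

Definition coupling (R : realType) (d : measure_display) (T : measurableType d)
    (P Q : probability T R) : set (probability (T * T)%type R) :=
  [set g | forall A, measurable A ->
             g (A `*` setT) = P A /\ g (setT `*` A) = Q A].

Definition wasserstein1 (R : realType) (n : nat) (Z : set 'rV[R]_n)
    (Z0 : Z !=set0) (P Q : probability (borel_space Z0) R) : \bar R :=
  ereal_inf [set (\int[g]_x (dist2 x.1 x.2)%:E)%E | g in coupling P Q].

Section performative.
Context (R : realType) (N m M : nat) (Z : set 'rV[R]_M) (Z0 : Z !=set0).
Context (p : 'I_N -> R) (D : 'I_N -> 'rV[R]_m -> probability (borel_space Z0) R)
  (l : 'rV[R]_m -> borel_space Z0 -> R).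

(* [fine] is only meaningful when the expectation is finite. *)
Definition client_risk (i : 'I_N) (theta theta' : 'rV[R]_m) : R :=
  fine ('E_(D i theta')[l theta])%E.

Definition risk (theta theta' : 'rV[R]_m) : R :=
  \sum_(i < N) p i * client_risk i theta theta'.

Definition performative_stable (theta : 'rV[R]_m) : Prop :=
  argmin (fun theta' => risk theta' theta) theta.

Definition performative_optimal (theta : 'rV[R]_m) : Prop :=
  argmin (fun theta' => risk theta' theta') theta.

End performative.

(* Main.v *)
(* Stationarity of theta^PS and strong convexity give
   mu/2 d^2 <= f(theta^PO; theta^PS) - f(theta^PS; theta^PS) with
   d = |theta^PS - theta^PO|.  Optimality of theta^PO lets one replace
   f(theta^PS; theta^PS) by the smaller f(theta^PO; theta^PO), so that only the
   distribution changes in the difference; the easy half of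
   Kantorovich-Rubinstein duality and sensitivity bound it by
   Lz (sum_i p_i eps_i) d.  Dividing by d concludes. *)

Require Import Defs.
From mathcomp Require Import all_boot all_order all_algebra.
From mathcomp Require Import all_classical all_reals all_analysis.
From mathcomp Require Import measurable_realfun lra.
Import Order.TTheory GRing.Theory Num.Theory.
Import numFieldNormedType.Exports.

Set Implicit Arguments.
Unset Strict Implicit.

Local Open Scope classical_set_scope.
Local Open Scope ring_scope.

Lemma norm2_ge0 (R : realType) (n : nat) (u : 'rV[R]_n) : 0 <= norm2 u.
Proof. exact: sqrtr_ge0. Qed.

Lemma norm2N (R : realType) (n : nat) (u : 'rV[R]_n) : norm2 (- u) = norm2 u.
Proof.
by rewrite /norm2 /dotp; congr Num.sqrt; apply: eq_bigr => i _;
  rewrite !mxE mulrNN.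
Qed.

(** Fermat's rule along each coordinate line: the restriction [h] of [g] to the line through [x] has
    a minimum at the interior point 0 of ]-1, 1[. *)
Lemma gradient_argmin (R : realType) (n : nat) (g : 'rV[R]_n -> R)
  (x : 'rV[R]_n) :
  (forall y, differentiable g y) -> argmin g x -> gradient g x = 0.
Proof.
move=> dg gmin; apply/rowP => i; rewrite !mxE.
set v := delta_mx 0 i; pose h t := g (t *: v + x).
have dh t : derivable h t 1.
  apply: diff_derivable; rewrite -[h]/(g \o (fun t => t *: v + x)).
  apply: differentiable_comp => //; apply: differentiableD => //.
have h0min : is_derive (0 : R) 1 h 0.
  apply: (@derive1_at_min _ h (-1) 1) => //.
  - by rewrite in_itv/= ltrN10 ltr01.
  - by move=> t _; rewrite /h scale0r add0r; exact: gmin.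
apply: etrans (@derive_val _ _ _ _ _ _ _ h0min).
(* Both derivatives are limits of one and the same difference quotient. *)
rewrite /derive; set q := (fun t => _); set r := (X in _ = lim (X @ _)).
suff -> : q = r by [].
by apply/funext => t; rewrite /q /r /h /= addr0 scale0r add0r [_%:A]mulr1.
Qed.

(* Unlike [ge0_le_integral], no measurability is required: the integral is a
   supremum over simple functions.  This spares proving that [dist2] is
   measurable for the product sigma-algebra. *)
Lemma ge0_le_integralT d (T : measurableType d) (R : realType)
  (mu : {measure set T -> \bar R}) (f g : T -> \bar R) :
  (forall x, 0 <= f x)%E -> (forall x, f x <= g x)%E ->
  (\int[mu]_x f x <= \int[mu]_x g x)%E.
Proof.
move=> f0 fg; rewrite !ge0_integralTE//; last first.
  by move=> x; exact: le_trans (fg x).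
apply: le_ereal_sup => _ [h hf <-]; exists h => // x.
exact: le_trans (fg x).
Qed.

Section image_measure.
Context d1 d2 (X : measurableType d1) (Y : measurableType d2) (R : realType).
Context (phi : X -> Y) (mphi : measurable_fun setT phi).
Context (mu : {measure set X -> \bar R}) (P : {measure set Y -> \bar R}).
Hypothesis mu_phi : forall A, measurable A -> mu (phi @^-1` A) = P A.
Context (f : Y -> \bar R).
Hypothesis f_int : P.-integrable setT f.

Let mf : measurable_fun setT f.
Proof. by case/integrableP : f_int. Qed.

(** Change of variables for [abse \o f]: the pushforward of [mu] agrees with [P] on measurable sets.
    It will serve for the two projections of a coupling. *)
Lemma integrable_image_measure : mu.-integrable setT (f \o phi).
Proof.
apply/integrableP; split; first exact: measurableT_comp.
case/integrableP : f_int => _; apply: le_lt_trans.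
have := @ge0_integral_pushforward _ _ _ _ _ _ mphi mu setT (abse \o f).
rewrite preimage_setT => /= <- //; last exact: measurableT_comp.
rewrite le_eqVlt; apply/orP; left; apply/eqP.
apply: (eq_measure_integral P) => A mA _.
exact: mu_phi.
Qed.

Lemma integral_image_measure : (\int[mu]_x f (phi x) = \int[P]_y f y)%E.
Proof.
have := @integral_pushforward _ _ _ _ _ _ mphi mu setT f mf.
rewrite preimage_setT => /(_ integrable_image_measure measurableT) /= <-.
apply: (eq_measure_integral P) => A mA _.
exact: mu_phi.
Qed.

End image_measure.

Section kantorovich.
Context (R : realType) (n : nat) (Z : set 'rV[R]_n) (Z0 : Z !=set0).
Context (P Q : probability (borel_space Z0) R) (h : borel_space Z0 -> R).
Hypothesis hP : P.-integrable setT (EFin \o h).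
Hypothesis hQ : Q.-integrable setT (EFin \o h).
Context (L : R) (L_ge0 : 0 <= L).
Hypothesis hL : forall z z', `|h z - h z'| <= L * dist2 z z'.

(** The marginals of [g] turn the left side into the integral of [h x.1 - h x.2] against [g], to
    which the Lipschitz bound applies pointwise. *)
Lemma expectationB_le_coupling
  (g : probability (borel_space Z0 * borel_space Z0)%type R) :
  coupling P Q g ->
  ('E_P[h] - 'E_Q[h] <= L%:E * \int[g]_x (dist2 x.1 x.2)%:E)%E.
Proof.
move=> gPQ; rewrite unlock.
have g1 A : measurable A -> g (fst @^-1` A) = P A.
  by move=> mA; rewrite -(gPQ A mA).1 setXT.
have g2 A : measurable A -> g (snd @^-1` A) = Q A.
  by move=> mA; rewrite -(gPQ A mA).2 setTX.
have i1 := integrable_image_measure measurable_fst g1 hP.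
have i2 := integrable_image_measure measurable_snd g2 hQ.
rewrite -(integral_image_measure measurable_fst g1 hP).
rewrite -(integral_image_measure measurable_snd g2 hQ).
rewrite -(integralB_EFin measurableT i1 i2).
have mB : measurable_fun setT (fun x : borel_space Z0 * borel_space Z0 =>
    (h x.1)%:E - (h x.2)%:E)%E.
  by case/integrableP : (integrableB measurableT i1 i2).
apply: (le_trans (lee_abs _)).
apply: (le_trans (le_abse_integral _ _ mB)) => //.
(* The main case divides by [L]; for [L = 0] the function [h] is constant and both sides vanish. *)
move: L_ge0; rewrite le_eqVlt => /predU1P[L0|L_gt0].
  rewrite -L0 mul0e integral0_eq// => x _.
  have := hL x.1 x.2; rewrite -L0 mul0r normr_le0 => /eqP h12.
  by rewrite -EFinB h12 abse0.
(* Extracting a scalar from an integral asks for a measurable integrand, which is at hand for [F],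
   not for [dist2]. So [L] is factored out of [F] first, and only then is [L^-1 * F] compared with
   [dist2]. *)
pose F (x : borel_space Z0 * borel_space Z0) := `|(h x.1)%:E - (h x.2)%:E|%E.
have F0 x : (0 <= L^-1%:E * F x)%E.
  by rewrite mule_ge0 ?abse_ge0// lee_fin invr_ge0 ltW.
have Fint : (\int[g]_x F x = L%:E * \int[g]_x (L^-1%:E * F x))%E.
  rewrite -ge0_integralZl_EFin ?(ltW L_gt0)//; last first.
    by apply: (@measurable_funeM _ _ _ setT F L^-1%:E); exact: measurableT_comp.
  by apply: eq_integral => x _; rewrite muleA -EFinM divff ?gt_eqF// mul1r.
rewrite [leLHS]Fint lee_pmul2l//; apply: ge0_le_integralT => // x.
by rewrite /F -EFinB -EFinM lee_fin ler_pdivrMl.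
Qed.

(** No optimal coupling is invoked: near-optimal ones give the bound up to an arbitrary [e > 0]. *)
Lemma expectationB_le_wasserstein1 (c : R) :
  (wasserstein1 P Q <= c%:E)%E -> fine 'E_P[h] - fine 'E_Q[h] <= L * c.
Proof.
move=> Wc.
have EP : 'E_P[h]%E \is a fin_num.
  by rewrite unlock; exact: integrable_fin_num hP.
have EQ : 'E_Q[h]%E \is a fin_num.
  by rewrite unlock; exact: integrable_fin_num hQ.
rewrite -fineB// -lee_fin fineK ?fin_numB ?EP// EFinM.
apply/lee_addgt0Pr => e e_gt0.
(* The slack [e / (L + 1)] makes sense even for [L = 0], and [L] times it is at most [e]. *)
have L1_gt0 : 0 < L + 1 by rewrite ltr_pwDr.
have Wlt : (wasserstein1 P Q < (c + e / (L + 1))%:E)%E.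
  by apply: le_lt_trans Wc _; rewrite lte_fin ltrDl divr_gt0.
have [_ [g gPQ <-] /ltW cost_g] := ereal_inf_lt Wlt.
apply: le_trans (expectationB_le_coupling gPQ) _.
apply: (@le_trans _ _ (L%:E * (c + e / (L + 1))%:E)%E).
  exact: lee_wpmul2l.
rewrite -!EFinM -EFinD lee_fin mulrDr lerD2l mulrCA ler_piMr ?(ltW e_gt0)//.
by rewrite ler_pdivrMr// mul1r lerDl.
Qed.

End kantorovich.

Unset Implicit Arguments.
Set Strict Implicit.

Theorem proposition2p9 (R : realType) (N m M : nat)
  (N_gt0 : (0 < N)%N) (m_gt0 : (0 < m)%N) (M_gt0 : (0 < M)%N)
  (p : 'I_N -> R) (p_gt0 : forall i, 0 < p i) (p_sum1 : \sum_(i < N) p i = 1)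
  (Z : set 'rV[R]_M) (Z0 : Z !=set0)
  (D : 'I_N -> 'rV[R]_m -> probability (borel_space Z0) R)
  (l : 'rV[R]_m -> borel_space Z0 -> R)
  (l_integrable : forall i (theta theta' : 'rV[R]_m),
     (D i theta').-integrable [set: borel_space Z0] (EFin \o l theta))
  (f_differentiable : forall theta theta' : 'rV[R]_m,
     differentiable (fun x => risk p D l x theta') theta)
  (mu : R) (mu_gt0 : 0 < mu)
  (f_strongly_convex : forall theta theta' theta'' : 'rV[R]_m,
     risk p D l theta theta''
     + dotp (gradient (fun x => risk p D l x theta'') theta) (theta' - theta)
     + mu / 2 * norm2 (theta' - theta) ^+ 2 <= risk p D l theta' theta'')
  (eps : 'I_N -> R) (eps_gt0 : forall i, 0 < eps i)
  (D_sensitive : forall i (theta theta' : 'rV[R]_m),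
     (wasserstein1 (D i theta) (D i theta')
      <= (eps i * norm2 (theta - theta'))%:E)%E)
  (Lz : R) (Lz_ge0 : 0 <= Lz)
  (l_lipschitz : forall (theta : 'rV[R]_m) (z z' : borel_space Z0),
     `|l theta z - l theta z'| <= Lz * dist2 z z')
  (thetaPS thetaPO : 'rV[R]_m)
  (thetaPS_stable : performative_stable p D l thetaPS)
  (thetaPO_optimal : performative_optimal p D l thetaPO) :
  norm2 (thetaPS - thetaPO) <= 2 * Lz * (\sum_(i < N) p i * eps i) / mu.
Proof.
set d := norm2 _.
have d0 : 0 <= d by exact: norm2_ge0.
set e := \sum_(i < N) _.
have e0 : 0 <= e by apply: sumr_ge0 => i _; rewrite mulr_ge0 ?ltW.
have grad0 : gradient (fun x => risk p D l x thetaPS) thetaPS = 0.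
  by apply: gradient_argmin => // y; exact: f_differentiable.
have convPS := f_strongly_convex thetaPS thetaPO thetaPS.
have {convPS} : mu / 2 * d ^+ 2 <=
    risk p D l thetaPO thetaPS - risk p D l thetaPO thetaPO.
  rewrite lerBrDl; apply: le_trans convPS.
  rewrite grad0 /dotp big1 ?addr0; last by move=> i _; rewrite mxE mul0r.
  by rewrite -(norm2N (thetaPO - thetaPS)) opprB lerD2r; exact: thetaPO_optimal.
have shift : risk p D l thetaPO thetaPS - risk p D l thetaPO thetaPO
    <= Lz * e * d.
  (* Client by client, with [c = eps i * d], after cancelling the weight [p i > 0]. *)
  rewrite -sumrB /e mulr_sumr mulr_suml; apply: ler_sum => i _.
  rewrite -mulrBr mulrCA -mulrA ler_pM2l// -mulrA.
  exact: (expectationB_le_wasserstein1 _ _ _ _ (D_sensitive i thetaPS thetaPO)).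
move=> /le_trans /(_ shift) {shift}.
(* If [d = 0], the bound holds because its right side is nonnegative; otherwise one factor [d]
   cancels. *)
move: d0; rewrite le_eqVlt => /predU1P[<- _|d_gt0].
  by rewrite divr_ge0 ?mulr_ge0// ltW.
by rewrite expr2 mulrA ler_pM2r// ler_pdivlMr//; lra.
Qed.
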